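(* Assume $h_A=1$. If $L/E$ is a finite cyclotomic coradical extension (with respect to $\rho$), then $[L:E]=p^{n}$ for some integer $n\ge 0$.
   Context: Let $q$ be a power of a prime $p$, let $K$ be a global function field with constant field $\mathbb{F}_q$, let $\mathfrak{p}_\infty$ be a fixed place of $K$ and $A=\{x\in K\mid v_{\mathfrak p}(x)\ge 0 \text{ for every place } \mathfrak p\ne \mathfrak p_\infty\}$. The class number of the Dedekind ring $A$ is denoted $h_A$ (so $h_A=1$ means that $A$ is a principal ideal domain). Let $E$ be a finite extension of $K$ and let $\rho\colon A\to E\langle\tau\rangle$, $a\mapsto\rho_a$, be an $A$-Drinfeld module of rank one over $E$, of generic characteristic (its structural map $\delta\colon A\to E$ is the natural embedding); here $\tau$ is the $q$-Frobenius, and $\rho_a$ is also regarded as an $\mathbb{F}_q$-linear polynomial $\rho_a(U)\in E[U]$. All algebraic extensions of $E$ are taken inside a fixed algebraic closure $\overline{K}$ of $K$; any extension $L$ of $E$ is an $A$-module via $a\cdot u=\rho_a(u)$. For an ideal $I$ of $A$, $\rho[I]=\{u\in\overline K\mid \rho_c(u)=0\text{ for all }c\in I\}$, and $\rho[a]=\rho[(a)]$. For $a\in A\setminus\{0\}$, $\lambda_a$ denotes a generator of the cyclic $A$-module $\rho[a]$ (whether $\lambda_a$ lies in an extension of $E$ does not depend on the choice of generator). For an extension $L/E$ put $\mathrm{DrinT}(L/E)=\{u\in L\mid \text{there is } m\in A\setminus\{0\}\text{ with }\rho_m(u)\in E\}$. The extension $L/E$ is called radical if $L=E(X)$ for some subset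 $X\subseteq \mathrm{DrinT}(L/E)$; it is called pure if for every irreducible $m\in A$, $\lambda_m\in L$ implies $\lambda_m\in E$; it is called cyclotomic coradical if it is radical, separable and pure. *)

(* Defs.v *)
From HB Require Import structures.
From mathcomp Require Import all_boot all_order all_fingroup all_algebra all_field.

Set Implicit Arguments.
Unset Strict Implicit.
Unset Printing Implicit Defensive.

Import Order.TTheory GRing.Theory Num.Theory.
Local Open Scope ring_scope.

(* A global function field over F_q is a finite extension K of F_q(t), i.e.
   K : fieldExtType (ratfun F) with F a finite field. *)
Notation ratfun F := {fraction {poly F}}.

Definition fconst (F : finFieldType) (K : fieldExtType (ratfun F)) (c : F) : K :=
  in_alg K (tofrac c%:P).

Definition full_constant_field (F : finFieldType)
    (K : fieldExtType (ratfun F)) : Prop :=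
  forall x : K, algebraicOver (@fconst F K) x -> exists c : F, x = fconst K c.

(* Places are given by their normalized discrete valuations.  The value at 0
   is irrelevant: everywhere below, 0 is treated as having valuation +oo.
   Triviality on the finite field F_q is automatic. *)
Record place (K : fieldType) := Place {
  pval :> K -> int;
  pvalM : forall x y, x != 0 -> y != 0 -> pval (x * y) = pval x + pval y;
  pvalD : forall x y, x != 0 -> y != 0 -> x + y != 0 ->
            Num.min (pval x) (pval y) <= pval (x + y);
  pval_normalized : exists2 x, x != 0 & pval x = 1 }.

Definition same_place (K : fieldType) (v w : place K) : Prop :=
  forall x, x != 0 -> v x = w x.

Definition regular_ring (K : fieldType) (vinf : place K) (x : K) : Prop :=
  forall v : place K, ~ same_place v vinf -> x = 0 \/ 0 <= v x.

(* Below, a subring A of K is given by its membership predicate. *)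

Definition principal_ideal (K : fieldType) (A : K -> Prop) (a : K) : K -> Prop :=
  fun x => exists2 b, A b & x = a * b.

Definition A_unit (K : fieldType) (A : K -> Prop) (a : K) : Prop :=
  A a /\ exists2 b, A b & a * b = 1.

Definition A_irreducible (K : fieldType) (A : K -> Prop) (m : K) : Prop :=
  [/\ A m, m != 0, ~ A_unit A m &
      forall a b, A a -> A b -> m = a * b -> A_unit A a \/ A_unit A b].

Definition fractional_ideal (K : fieldType) (A : K -> Prop) (I : K -> Prop) : Prop :=
  [/\ (exists2 x, x != 0 & I x),
      (forall x y, I x -> I y -> I (x + y)),
      (forall a x, A a -> I x -> I (a * x)) &
      exists d, [/\ A d, d != 0 & forall x, I x -> A (d * x)]].

Definition same_class (K : fieldType) (I J : K -> Prop) : Prop :=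
  exists2 c : K, c != 0 & forall x, I x <-> exists2 y, J y & x = c * y.

(* [r] is a system of representatives of the ideal class group of A. *)
Definition class_number_is (K : fieldType) (A : K -> Prop) (h : nat) : Prop :=
  exists r : 'I_h -> (K -> Prop),
    (forall i, fractional_ideal A (r i)) /\
    forall I, fractional_ideal A I -> exists! i, same_class I (r i).

(* deg(a) = dim_{F_q} (A/aA): [b] lifts a basis of A/aA. *)
Definition deg_is (F : finFieldType) (K : fieldExtType (ratfun F))
    (A : K -> Prop) (a : K) (d : nat) : Prop :=
  exists b : 'I_d -> K, (forall i, A (b i)) /\
    forall x, A x -> exists! c : {ffun 'I_d -> F},
      principal_ideal A a (x - \sum_i fconst K (c i) * b i).

(* A twisted polynomial  \sum_i f_i tau^i  in E<tau> is represented by the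
   {poly E} with the same coefficients; only the product differs, being
   determined by  tau * c = c^q * tau. *)
Definition twisted_mul (E : fieldType) (q : nat) (f g : {poly E}) : {poly E} :=
  \sum_(i < size f) \sum_(j < size g)
     (f`_i * g`_j ^+ (q ^ i)%N) *: 'X^(i + j).

(* The F_q-linear polynomial  \sum_i f_i U^(q^i)  attached to f. *)
Definition linearized (E : fieldType) (q : nat) (f : {poly E}) : {poly E} :=
  \sum_(i < size f) f`_i *: 'X^(q ^ i)%N.

(* The structural map delta is the embedding in_alg E of K in E.
   Values of [rho] outside A are irrelevant. *)
Record drinfeld_module (F : finFieldType) (K : fieldExtType (ratfun F))
    (A : K -> Prop) (E : fieldExtType K) := DrinfeldModule {
  rho :> K -> {poly E};
  rhoD : forall a b, A a -> A b -> rho (a + b) = rho a + rho b;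
  rhoM : forall a b, A a -> A b -> rho (a * b) = twisted_mul #|F| (rho a) (rho b);
  rho_const : forall c : F, rho (fconst K c) = (in_alg E (fconst K c))%:P;
  rho_delta : forall a, A a -> (rho a)`_0 = in_alg E a;
  rho_nontrivial : exists2 a, A a & (1 < size (rho a))%N }.

(* deg_tau (rho_a) = r * deg(a) for every nonzero a. *)
Definition has_rank (F : finFieldType) (K : fieldExtType (ratfun F))
    (A : K -> Prop) (E : fieldExtType K) (phi : drinfeld_module A E) (r : nat) : Prop :=
  forall a, A a -> a != 0 ->
    exists2 d, deg_is A a d & (size (phi a)).-1 = (r * d)%N.

(* rho_a(u), for u in an overfield M of E given by an embedding e. *)
Definition drinfeld_act (F : finFieldType) (K : fieldExtType (ratfun F))
    (A : K -> Prop) (E : fieldExtType K) (phi : drinfeld_module A E)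
    (M : fieldType) (e : E -> M) (a : K) (u : M) : M :=
  (map_poly e (linearized #|F| (phi a))).[u].

Definition torsion (F : finFieldType) (K : fieldExtType (ratfun F))
    (A : K -> Prop) (E : fieldExtType K) (phi : drinfeld_module A E)
    (M : fieldType) (e : E -> M) (I : K -> Prop) (u : M) : Prop :=
  forall c, I c -> drinfeld_act phi e c u = 0.

(* l is a generator lambda_a of the A-module rho[a]. *)
Definition torsion_generator (F : finFieldType) (K : fieldExtType (ratfun F))
    (A : K -> Prop) (E : fieldExtType K) (phi : drinfeld_module A E)
    (M : fieldType) (e : E -> M) (a : K) (l : M) : Prop :=
  torsion phi e (principal_ideal A a) l /\
  forall u, torsion phi e (principal_ideal A a) u ->
    exists2 b, A b & u = drinfeld_act phi e b l.

Definition DrinT (F : finFieldType) (K : fieldExtType (ratfun F))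
    (A : K -> Prop) (E : fieldExtType K) (phi : drinfeld_module A E)
    (L : fieldExtType E) (u : L) : Prop :=
  exists m, [/\ A m, m != 0 &
    exists y : E, drinfeld_act phi (in_alg L) m u = in_alg L y].

Definition generated_by (E : fieldType) (L : fieldExtType E) (X : L -> Prop) : Prop :=
  forall M : {subfield L}, (forall u, X u -> u \in M) -> (M : {vspace L}) = fullv.

Definition radical (F : finFieldType) (K : fieldExtType (ratfun F))
    (A : K -> Prop) (E : fieldExtType K) (phi : drinfeld_module A E)
    (L : fieldExtType E) : Prop :=
  exists X : L -> Prop, (forall u, X u -> DrinT phi u) /\ generated_by X.

(* iE and iL are the inclusions of E and L in the algebraic closure of K. *)
Definition pure (F : finFieldType) (K : fieldExtType (ratfun F))
    (A : K -> Prop) (E : fieldExtType K) (phi : drinfeld_module A E)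
    (L : fieldExtType E) (Kbar : closedFieldType)
    (iE : {rmorphism E -> Kbar}) (iL : {rmorphism L -> Kbar}) : Prop :=
  forall m, A_irreducible A m ->
  forall l : Kbar, torsion_generator phi iE m l ->
    (exists x : L, iL x = l) -> exists y : E, iE y = l.

Definition cyclotomic_coradical (F : finFieldType) (K : fieldExtType (ratfun F))
    (A : K -> Prop) (E : fieldExtType K) (phi : drinfeld_module A E)
    (L : fieldExtType E) (Kbar : closedFieldType)
    (iE : {rmorphism E -> Kbar}) (iL : {rmorphism L -> Kbar}) : Prop :=
  [/\ radical phi L, separable 1 {:L} & pure phi iE iL].

(* Main.v *)
Require Import Defs.
From HB Require Import structures.
From mathcomp Require Import all_boot all_order all_fingroup all_algebra all_field.
From mathcomp Require Import all_solvable.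
From Stdlib Require Classical_Prop.

(** Let N be the Galois closure of L over E, G its Galois group and H the
    subgroup fixing L, so that [L:E] = |G : H|. The theorem says that H contains
    a Hall p'-subgroup of G.

    Each generator u of L lies in DrinT(L/E), so g u - u is a torsion point of
    rho for every g in G: the extension is governed by cocycles of G with values
    in torsion, a group of exponent p. Such cocycles are trivial on p'-groups in
    the sense that u can be moved into the fixed field by adding a torsion
    point; what has to be shown is that no correction is needed, and purity is
    what guarantees it.

    The arithmetic input concerns the socle of the torsion module, that is the
    points killed by some irreducible m. Because A is principal and rho has rank
    one, rho[m] is a simple A-module all of whose nonzero points generate it
    ([irreducible_torsion_cyclic]), and each nonzero torsion point has a nonzero
    multiple in some rho[m] ([irreducible_torsion_multiple]). Consequently G acts
    on rho[m] through scalars, hence commutatively ([irreducible_point_comm]);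
    elements of p-power order act trivially there ([irreducible_point_pgroup]);
    and purity says that a point of rho[m] fixed by H is fixed by G
    ([irreducible_point_pure]).

    The rest is group theory ([index_pnat]). An automorphism of order prime to p
    cannot act as a nontrivial unipotent in characteristic p
    ([unipotent_trivial]), so its action on torsion, and on elements whose
    displacement is torsion, is detected on the socle ([socle_controls]).
    This makes the derived subgroup of G a p-group, so that G is solvable and its
    Hall p'-subgroups are abelian. Take Hall p'-subgroups D of H and C of G with D
    contained in C. For g in C, the displacement g u - u is fixed by D, and purity
    makes C fix the part of the socle that D fixes; therefore g u = u, so that C
    is contained in H and |G : H| is a power of p. *)

Set Implicit Arguments.
Unset Strict Implicit.
Unset Printing Implicit Defensive.

Import Order.TTheory GRing.Theory Num.Theory.
Local Open Scope ring_scope.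

(** * A p-power index criterion for groups acting in characteristic p *)

(** The setting of the whole section, read in the application: [V] is the
    Galois closure of the extension, [T] its torsion points, [Soc] its nonzero
    torsion points killed by an irreducible element, [X] a generating set of
    the extension and [H] the subgroup fixing the extension. *)
Section PureSocle.
Variables (p : nat) (gT : finGroupType) (G : {group gT}) (V : zmodType).
Variable act : V -> gT -> V.
Hypothesis charV : forall v : V, v *+ p = 0.
Hypothesis actD : {in G, forall g u v, act (u + v) g = act u g + act v g}.
Hypothesis act1 : forall u, act u 1%g = u.
Hypothesis actM : {in G &, forall g h u, act u (g * h)%g = act (act u g) h}.

Lemma act_sub g u v : g \in G -> act (u - v) g = act u g - act v g.
Proof. by move=> Gg; apply: (addIr (act v g)); rewrite -actD // !subrK. Qed.

Lemma act_0 g : g \in G -> act 0 g = 0.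
Proof. by move=> Gg; have := act_sub 0 0 Gg; rewrite !subrr. Qed.

(** Iterating gives g^n u = u + n x, and a vector killed by both the order
    of g and p is zero. *)
Lemma unipotent_trivial g u x : g \in G -> coprime #[g]%g p ->
  act u g = u + x -> act x g = x -> x = 0.
Proof.
move=> Gg co_g gu gx.
have gX n : act u (g ^+ n)%g = u + x *+ n.
  elim: n => [|n IHn]; first by rewrite expg0 act1 addr0.
  have gxn : act (x *+ n) g = x *+ n.
    elim: n {IHn} => [|n IHn]; first by rewrite act_0.
    by rewrite mulrS actD // gx IHn.
  by rewrite expgSr actM ?groupX // IHn actD // gu gxn -addrA -mulrS.
have xg0 : x *+ #[g]%g = 0.
  by apply: (addrI u); rewrite -gX expg_order act1 addr0.
have [a b Dab _] := egcdnP p (order_gt0 g).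
have: x *+ (a * #[g]%g) = x *+ (b * p + 1).
  by rewrite Dab; congr (_ *+ (_ + _)%N); apply/eqP.
by rewrite mulnC mulrnA xg0 mul0rn mulrnDr mulnC mulrnA charV mul0rn add0r.
Qed.

Variables (T Soc : V -> Prop).
Hypothesis T_sub : forall x y, T x -> T y -> T (x - y).
Hypothesis T_act : forall x g, g \in G -> T x -> T (act x g).
(* Every nonzero submodule meets the socle, with scalars being additive maps
   commuting with the group. *)
Hypothesis to_socle : forall y, T y -> y != 0 ->
  exists f : V -> V, [/\ {morph f : u v / u + v},
    {in G, forall g u, act (f u) g = f (act u g)}, f y != 0 & Soc (f y)].

(** Replacement for the vanishing of H^1 of a p'-group, reduced to the socle.
    With x = g u - u, a nonzero g x - x would have a nonzero multiple f (g x - x)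
    in the socle, fixed by D and hence by g; then g would act on f x as a
    nontrivial unipotent of order prime to p. So g fixes x, and the same
    unipotence argument applied to u gives x = 0. The set D enters so that only
    the D-fixed part of the socle has to be controlled. *)
Lemma socle_controls (D : {set gT}) g u : D \subset G -> g \in G ->
    coprime #[g]%g p -> {in D, forall h, commute h g} ->
    (forall z, Soc z -> {in D, forall h, act z h = z} -> act z g = z) ->
    T (act u g - u) -> {in D, forall h, act (act u g - u) h = act u g - u} ->
  act u g = u.
Proof.
move=> sDG Gg co_g cDg socD; set x := act u g - u => Tx xD.
have ug : act u g = u + x by rewrite addrC subrK.
suffices xg : act x g = x.
  by rewrite ug (unipotent_trivial Gg co_g ug xg) addr0.
apply/eqP; rewrite -subr_eq0; apply/negP => /negP nz_y.
have [f [fD fC nz_fy soc_fy]] := to_socle (T_sub (T_act Gg Tx) Tx) nz_y.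
have yD : {in D, forall h, act (f (act x g - x)) h = f (act x g - x)}.
  move=> h Dh; have Gh := subsetP sDG h Dh.
  by rewrite fC // act_sub // -actM // -(cDg h Dh) actM // xD.
case/eqP: nz_fy; apply: (unipotent_trivial (u := f x) Gg co_g).
  by rewrite fC // -fD addrC subrK.
exact: socD.
Qed.

Variables (H : {group gT}) (X : V -> Prop).
Hypothesis pr_p : prime p.
Hypothesis sHG : H \subset G.
Hypothesis socle_comm : forall z, Soc z -> {in G &, forall g h,
  act z (g * h)%g = act z (h * g)%g}.
Hypothesis socle_p : forall z, Soc z -> {in G, forall g,
  p.-nat #[g]%g -> act z g = z}.
Hypothesis socle_pure : forall z, Soc z -> {in H, forall h, act z h = z} ->
  {in G, forall g, act z g = z}.
Hypothesis XT : forall u, X u -> {in G, forall g, T (act u g - u)}.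
Hypothesis X_H : forall g, g \in G ->
  (g \in H <-> forall u, X u -> act u g = u).
Hypothesis X_faithful : forall g, g \in G ->
  (forall u h, X u -> h \in G -> act (act u h) g = act u h) -> g = 1%g.

Lemma stab_group_set z : group_set [set g in G | act z g == z].
Proof.
apply/group_setP; split=> [|g h]; first by rewrite inE group1 act1 eqxx.
rewrite !inE => /andP[Gg /eqP gz] /andP[Gh /eqP hz].
by rewrite groupM //= actM // gz hz.
Qed.
Canonical stab_group z := Group (stab_group_set z).

Lemma stabP z g : reflect (g \in G /\ act z g = z) (g \in stab_group z).
Proof. by rewrite inE; apply: (iffP andP) => -[? /eqP]. Qed.

(** The derived subgroup acts trivially on the socle, since the action there
    is commutative; an element of prime order other than p acting trivially on
    the socle fixes all conjugates of X, hence is trivial. *)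
Lemma der1_pgroup : (p.-group G^`(1))%g.
Proof.
have fixS z : Soc z -> G^`(1)%g \subset stab_group z.
  move=> soc_z; rewrite gen_subG; apply/subsetP => _ /imset2P[g h Gg Gh ->].
  apply/stabP; rewrite groupR //; split=> //.
  rewrite commgEl conjgE mulgA.
  rewrite actM ?groupM ?groupV // (socle_comm soc_z) ?groupV //.
  rewrite -actM ?groupM ?groupV //.
  by rewrite !mulgA mulgKV mulVg act1.
have sG'G : G^`(1)%g \subset G := der_sub 1 G.
rewrite /pgroup; apply/pnatP => // q pr_q /(Cauchy pr_q)[g G'g og].
apply/idPn => q'p; have co_g : coprime #[g]%g p.
  by rewrite og prime_coprime // dvdn_prime2.
suffices: g = 1%g.
  by move=> g1; move: og; rewrite g1 order1 => q1; rewrite -q1 in pr_q.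
have Gg := subsetP sG'G g G'g.
apply: X_faithful => // u h Xu Gh.
apply: (@socle_controls set0) => //; try by [rewrite sub0set | move=> ?; rewrite inE].
  by move=> z soc_z _; have /stabP[] := subsetP (fixS z soc_z) g G'g.
(* The displacement of a conjugate of u is the image of a displacement of u. *)
have ->: act (act u h) g - act u h = act (act u (h * g * h^-1)%g - u) h.
  by rewrite act_sub ?groupM ?groupV // -!actM ?groupM ?groupV // mulgKV.
set k := (_ * _)%g; have Gk : k \in G by rewrite !groupM ?groupV.
by apply: T_act => //; apply: XT.
Qed.

(** H contains a Hall p'-subgroup C of G. Choose C above a Hall p'-subgroup D
    of H; C is abelian, its derived subgroup being both a p-group and a
    p'-group. For u in X and g in C the displacement g u - u is fixed by D,
    because D fixes u and commutes with g. A socle element fixed by D is fixed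
    by H (p-elements fix the whole socle), so by G, and [socle_controls] shows
    that g fixes u. *)
Lemma index_pnat : p.-nat #|G : H|%g.
Proof.
have solG : solvable G.
  rewrite (series_sol (der_normal 1 G)).
  rewrite (pgroup_sol der1_pgroup) abelian_sol //.
  exact: der_abelian.
have [D hallD] := Hall_exists p^' (solvableS sHG solG).
have [sDH p'D _] := and3P hallD.
have sDG := subset_trans sDH sHG.
have [C hallC sDC] := Hall_superset solG sDG p'D.
have [sCG p'C _] := and3P hallC.
have abC : abelian C.
  apply/commG1P/eqP; rewrite trivg_card1.
  have pC' : (p.-group [~: C, C])%g by apply: pgroupS (commgSS sCG sCG) der1_pgroup.
  have p'C' : (p^'.-group [~: C, C])%g by apply: pgroupS p'C; apply: der_sub 1%N _.
  by rewrite -(pnat_1 pC' p'C').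
have co_C g : g \in C -> coprime #[g]%g p.
  move=> Cg; rewrite coprime_sym prime_coprime //.
  by rewrite -p'natE //; apply: mem_p_elt Cg.
have fixH z : Soc z -> {in D, forall h, act z h = z} -> {in H, forall h, act z h = z}.
  move=> soc_z Dz.
  suffices: H \subset stab_group z.
    by move=> sHS h Hh; have /stabP[] := subsetP sHS h Hh.
  have [S sylS] := Sylow_exists p H.
  have [sSH pS _] := and3P sylS.
  have sS : S \subset H :&: stab_group z.
    rewrite subsetI sSH; apply/subsetP=> h Sh; apply/stabP.
    have Gh := subsetP sHG h (subsetP sSH h Sh).
    by split=> //; apply: socle_p => //; apply: mem_p_elt Sh.
  have sD : D \subset H :&: stab_group z.
    rewrite subsetI sDH; apply/subsetP=> h Dh; apply/stabP.
    by split; [apply: (subsetP sDG) | apply: Dz].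
  suffices ->: (H :=: H :&: stab_group z)%g by apply: subsetIr.
  apply/eqP; rewrite eq_sym eqEcard subsetIl /=.
  rewrite -(partnC p (cardG_gt0 H)) -(card_Hall sylS) -(card_Hall hallD).
  apply: dvdn_leq => //; rewrite Gauss_dvd ?cardSg //.
  by rewrite (card_Hall sylS) (card_Hall hallD) coprime_partC.
have sCH : C \subset H.
  apply/subsetP => g Cg; have Gg := subsetP sCG g Cg.
  apply/X_H => // u Xu.
  apply: (@socle_controls D) => //; first exact: co_C.
  - by move=> h Dh; apply: (centsP abC) => //; apply: (subsetP sDC).
  - move=> z soc_z Dz; apply: socle_pure => //; exact: fixH.
  - exact: XT.
  move=> h Dh; have Gh := subsetP sDG h Dh.
  have hu : act u h = u := (X_H Gh).1 (subsetP sDH h Dh) u Xu.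
  rewrite act_sub // -actM // -(centsP abC h (subsetP sDC h Dh) g Cg).
  by rewrite actM // hu.
have pC : p.-nat #|G : C|%g.
  have [_ _] := and3P hallC.
  by apply: sub_in_pnat => q _; rewrite !inE /= negbK.
exact: pnat_dvd (indexgS G sCH) pC.
Qed.

End PureSocle.

(** * Galois closures inside an algebraically closed field *)

(** A polynomial of least degree among those annihilating z is irreducible;
    excluded middle provides one even though membership in the image of the
    embedding is not decidable. *)
Lemma irreducible_annihilator (F L : fieldType) (iota : {rmorphism F -> L}) z :
  algebraicOver iota z ->
  exists p : {poly F}, [/\ p != 0, root (map_poly iota p) z & irreducible_poly p].
Proof.
case=> p nz_p pz; move: {2}_.+1 (ltnSn (size p)) => n.
elim: n p nz_p pz => // n IHn p nz_p pz lt_pn; apply: Classical_Prop.NNPP => no_p.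
apply: (no_p); exists p; split=> //; apply/(subfx_irreducibleP pz nz_p) => q qz nz_q.
rewrite leqNgt; apply/negP => lt_qp; apply/no_p/(IHn q) => //.
exact: leq_trans lt_qp lt_pn.
Qed.

(** Generation is expressed by an induction principle on predicates closed
    under sums and products: unlike a statement about subfields, it pulls back
    along morphisms, so that successive adjunctions compose. *)
Lemma adjoin_algebraic (E : fieldType) (N : fieldExtType E) (M : fieldType)
    (iN : {rmorphism N -> M}) (z : M) : algebraicOver iN z ->
  exists (N' : fieldExtType E) (iN' : {rmorphism N' -> M})
      (g : {rmorphism N -> N'}) (z' : N'),
    [/\ forall a, g a%:A = a%:A, forall x, iN' (g x) = iN x, iN' z' = z &
      forall P : N' -> Prop, (forall u v, P u -> P v -> P (u + v)) ->
        (forall u v, P u -> P v -> P (u * v)) -> (forall x, P (g x)) -> P z' ->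
        forall w, P w].
Proof.
case/irreducible_annihilator=> p [nz_p pz irr_p].
pose S : fieldExtType N := SubFieldExtType pz irr_p.
exists (baseFieldType S), (@subfx_inj _ _ iN z p : {rmorphism _ -> _}).
exists (in_alg S : {rmorphism _ -> _}), (subfx_root iN z p).
split=> [a|x||P PD PM Pg Pz w].
- by [].
- exact: subfx_inj_base.
- exact: subfx_inj_root.
have [q ->] := subfxEroot pz nz_p w.
elim/poly_ind: q => [|q c IHq].
  by rewrite rmorph0 horner0 -(rmorph0 (in_alg S)); apply: Pg.
rewrite rmorphD rmorphM /= map_polyX map_polyC hornerMXaddC.
by apply: (PD) (PM _ _ IHq Pz) (Pg c).
Qed.

Lemma adjoin_algebraic_seq (E : fieldType) (L : fieldExtType E) (M : fieldType)
    (iL : {rmorphism L -> M}) (s : seq M) : (forall z, z \in s -> algebraicOver iL z) ->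
  exists (N : fieldExtType E) (iN : {rmorphism N -> M})
      (j : {rmorphism L -> N}) (s' : seq N),
    [/\ forall a, j a%:A = a%:A, forall x, iN (j x) = iL x, map iN s' = s &
      forall P : N -> Prop, (forall u v, P u -> P v -> P (u + v)) ->
        (forall u v, P u -> P v -> P (u * v)) -> (forall x, P (j x)) ->
        (forall z, z \in s' -> P z) -> forall w, P w].
Proof.
elim: s => [|z s IHs] algs.
  by exists L, iL, (idfun : {rmorphism L -> L}), [::]; split.
have [|N [iN [j [s' [ja ij Ds Ngen]]]]] := IHs.
  by move=> y sy; apply: algs; rewrite inE sy orbT.
have [|N' [iN' [g [z' [ga ig Dz N'gen]]]]] := @adjoin_algebraic E N M iN z.
  have [q nz_q qz] := algs z (mem_head _ _).
  exists (map_poly j q); first by rewrite map_poly_eq0.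
  by rewrite -map_poly_comp (eq_map_poly (g := iL)).
exists N', iN', (g \o j : {rmorphism L -> N'}), (z' :: map g s'); split=> /=.
- by move=> a; rewrite ja ga.
- by move=> x; rewrite ig ij.
- by rewrite Dz -map_comp (eq_map ig) Ds.
move=> P PD PM Pj Ps; apply: N'gen => //; last by apply: Ps; apply: mem_head.
apply: Ngen => [u v|u v|//|y sy]; rewrite ?rmorphD ?rmorphM; auto.
by apply: Ps; rewrite inE map_f ?orbT.
Qed.

(** The separable extension L is generated by one element x; adjoining to L all
    the roots in M of the minimal polynomial of x gives a splitting field of a
    separable polynomial. The last clause says that no nontrivial automorphism
    fixes every conjugate of L: N is generated by the roots, each of which is
    a conjugate of the image of x. *)
Lemma exists_galois_closure (E : fieldType) (L : fieldExtType E) (M : closedFieldType)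
    (iL : {rmorphism L -> M}) : separable 1 {:L} ->
  exists (N : splittingFieldType E) (iN : {rmorphism N -> M}) (j : 'AHom(L, N)),
    [/\ galois 1 {:N}, forall y, iN (j y) = iL y &
      forall g, g \in 'Gal({:N} / 1)%g ->
        (forall h y, h \in 'Gal({:N} / 1)%g -> g (h (j y)) = h (j y)) -> g = 1%g].
Proof.
move=> sepL; pose x := separable_generator 1 {:L}.
have genL : {:L}%VS = <<1; x>>%VS.
  by apply: eq_adjoin_separable_generator => //; apply: sub1v.
have /polyOver1P[f Df] := minPolyOver 1 x.
have sepx : separable_poly f.
  rewrite -(separable_map (in_alg L)) -Df.
  exact: separable_generatorP.
have mon_f : f \is monic by rewrite -(map_monic (in_alg L)) -Df monic_minPoly.
have [s Ds] := closed_field_poly_normal (map_poly iL (map_poly (in_alg L) f)).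
rewrite !(monicP _) ?map_monic // scale1r in Ds.
have [z|N [iN [j [s' [ja ij Ds' Ngen]]]]] := @adjoin_algebraic_seq E L M iL s.
  move=> sz; exists (map_poly (in_alg L) f); first by rewrite map_poly_eq0 monic_neq0.
  by rewrite Ds root_prod_XsubC.
have DfN : map_poly (in_alg N) f = \prod_(z <- s') ('X - z%:P).
  apply: (map_poly_inj iN); rewrite rmorph_prod /=.
  rewrite -(eq_bigr _ (fun z _ => esym (map_polyXsubC iN z))).
  rewrite -(big_map iN xpredT (fun z => 'X - z%:P)) Ds' -Ds.
  rewrite -!map_poly_comp; apply: eq_map_poly => a /=.
  by rewrite -ij ja.
have jx_s' : j x \in s'.
  rewrite -root_prod_XsubC -DfN.
  have -> : map_poly (in_alg N) f = map_poly j (map_poly (in_alg L) f).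
    by rewrite -map_poly_comp; apply: eq_map_poly => a /=; rewrite ja.
  by rewrite fmorph_root -Df root_minPoly.
have splitN : splittingFieldFor 1 (map_poly (in_alg N) f) {:N}.
  exists s'; first by rewrite DfN eqpxx.
  apply/eqP; rewrite eqEsubv subvf; apply/subvP => w _.
  apply: (Ngen (fun w => w \in <<1 & s'>>%VS)) => [u v|u v|y|z].
  - exact: rpredD.
  - exact: rpredM.
  - have : y \in <<1; x>>%VS by rewrite -genL memvf.
    case/Fadjoin_polyP => q /polyOver1P[q0 ->] ->.
    rewrite -horner_map -map_poly_comp; apply: rpred_horner.
      apply/polyOverP => i; rewrite coef_map /= ja; apply: rpredZ; exact: rpred1.
    exact: seqv_sub_adjoin.
  exact: seqv_sub_adjoin.
have fN1 : map_poly (in_alg N) f \is a polyOver 1%VS by apply/polyOver1P; exists f.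
have axN : splitting_field_axiom N by exists (map_poly (in_alg N) f).
pose SN : splittingFieldType E :=
  HB.pack (FieldExt.sort N) N (FieldExt_isSplittingField.Build E N axN).
have jZ : scalable j.
  by move=> a y; rewrite -mulr_algl rmorphM /= ja mulr_algl.
pose jL : {lrmorphism L -> SN} :=
  HB.pack (GRing.RMorphism.sort j) j (GRing.isScalable.Build E L N *:%R j jZ).
exists SN, iN, (linfun jL : 'AHom(L, SN)).
have galN : galois 1 {:SN}.
  apply/splitting_galoisField; exists (map_poly (in_alg SN) f); split=> //.
  by rewrite separable_map.
have normN : normalField 1 {:SN} by case/and3P: galN.
split=> // [y|g Gg fixg]; first by rewrite lfunE /= ij.
apply/eqP/gal_eqP => w _; rewrite gal_id.
apply: (Ngen (fun w : SN => g w = w)) => [u v /= gu gv|u v /= gu gv|y|z sz].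
- by transitivity (g u + g v); [apply: rmorphD | rewrite gu gv].
- by transitivity (g u * g v); [apply: rmorphM | rewrite gu gv].
- by have := fixg 1%g y (group1 _); rewrite !gal_id lfunE.
(* The minimal polynomials of x and of its image have the same coefficients
   in E, so every root in s' is a conjugate of the image of x. *)
have Px_z : root (minPoly 1 (jL x : SN)) z.
  have /polyOver1P[q Dq] := minPolyOver 1 (jL x : SN).
  have qx : root (map_poly (in_alg L) q) x.
    rewrite -(fmorph_root jL) -map_poly_comp -(eq_map_poly (f := in_alg SN)) => [|a /=].
      by rewrite -Dq root_minPoly.
    by rewrite ja.
  have : f %| q.
    rewrite -(dvdp_map (in_alg L)) -Df; apply: minPoly_dvdp => //.
    by apply/polyOver1P; exists q.
  rewrite -(dvdp_map (in_alg SN)) -Dq -dvdp_XsubCl => /(dvdp_trans _); apply.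
  by rewrite dvdp_XsubCl DfN root_prod_XsubC.
have [h Gh <-] := normalField_root_minPoly (sub1v _) normN (memvf (jL x : SN)) Px_z.
by have := fixg h x Gh; rewrite lfunE.
Qed.

(** * The ring of functions regular outside one place *)
Section RegularRing.
Variables (K : fieldType) (vinf : place K).
Local Notation A := (regular_ring vinf).

Lemma place_exp (v : place K) x n : x != 0 -> v (x ^+ n.+1) = v x *+ n.+1.
Proof.
move=> nz_x; elim: n => // n IHn.
by rewrite exprS pvalM ?expf_neq0 // IHn -mulrS.
Qed.

(** Roots of unity are regular everywhere; this covers the constants 1 and -1
    and the nonzero elements of the finite constant field alike. *)
Lemma place_unity (v : place K) x n : (0 < n)%N -> x ^+ n = 1 -> v x = 0.
Proof.
move=> n_gt0 xn1; have v1 : v 1 = 0.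
  by apply: (addIr (v 1)); rewrite -pvalM ?oner_neq0 // mulr1 add0r.
have nz_x : x != 0.
  by apply: contra_eq_neq xn1 => ->; rewrite expr0n gtn_eqF // eq_sym oner_eq0.
apply/eqP; have := place_exp v n.-1 nz_x; rewrite prednK // xn1 v1.
by move/esym/eqP; rewrite mulrn_eq0 gtn_eqF.
Qed.

Lemma regular_unity x n : (0 < n)%N -> x ^+ n = 1 -> A x.
Proof. by move=> n_gt0 xn1 v _; right; rewrite (place_unity v n_gt0 xn1). Qed.

Lemma regular1 : A 1.
Proof. exact: (@regular_unity 1 1). Qed.

Lemma regular0 : A 0.
Proof. by move=> v _; left. Qed.

Lemma regularM x y : A x -> A y -> A (x * y).
Proof.
move=> Ax Ay v Dv; have [->|nz_x] := eqVneq x 0; first by left; rewrite mul0r.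
have [->|nz_y] := eqVneq y 0; first by left; rewrite mulr0.
right; rewrite pvalM //; apply: addr_ge0.
  by have [/eqP|//] := Ax v Dv; rewrite (negPf nz_x).
by have [/eqP|//] := Ay v Dv; rewrite (negPf nz_y).
Qed.

Lemma regularD x y : A x -> A y -> A (x + y).
Proof.
move=> Ax Ay v Dv; have [->|nz_x] := eqVneq x 0; first by rewrite add0r; apply: Ay.
have [->|nz_y] := eqVneq y 0; first by rewrite addr0; apply: Ax.
have [->|nz_xy] := eqVneq (x + y) 0; first by left.
right; apply: le_trans (pvalD v nz_x nz_y nz_xy).
rewrite le_min; apply/andP; split.
  by have [/eqP|//] := Ax v Dv; rewrite (negPf nz_x).
by have [/eqP|//] := Ay v Dv; rewrite (negPf nz_y).
Qed.

Lemma regularN1 : A (-1).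
Proof. by apply: (@regular_unity _ 2) => //; rewrite sqrrN expr1n. Qed.

Lemma regularB x y : A x -> A y -> A (x - y).
Proof.
by move=> Ax Ay; rewrite -mulN1r; apply: regularD => //; apply: regularM regularN1 _.
Qed.

Lemma regular_sum (I : finType) (f : I -> K) : (forall i, A (f i)) -> A (\sum_i f i).
Proof.
by move=> Af; exact: (big_ind A regular0 regularD (fun i _ => Af i)).
Qed.

(** The ring itself is a fractional ideal, hence in the same class as I. *)
Lemma class_number1_principal I : class_number_is A 1 -> fractional_ideal A I ->
  exists g, forall x, I x <-> principal_ideal A g x.
Proof.
case=> r [_ rep] frI.
have frA : fractional_ideal A A.
  split; first by exists 1; rewrite ?oner_neq0 //; apply: regular1.
  - exact: regularD.
  - exact: regularM.
  by exists 1; split=> [||x Ax]; [apply: regular1 | apply: oner_neq0 | rewrite mul1r].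
have [i [[c nz_c Ic] _]] := rep I frI.
have [j [[c' nz_c' Ac'] _]] := rep A frA.
rewrite (ord1 i) in Ic; rewrite (ord1 j) in Ac'.
exists (c / c') => x; split=> [/Ic[y ry ->]|[b /Ac'[y ry ->] ->]].
  by exists (c' * y); [apply/Ac'; exists y | rewrite mulrA mulfVK].
by apply/Ic; exists y; rewrite // mulrA mulfVK.
Qed.

End RegularRing.

(** * Linearized polynomials *)
Section Linearized.
Variables (E : fieldType) (p k : nat).
Hypotheses (charE : p \in [pchar E]) (k_gt0 : (0 < k)%N).
Local Notation q := (p ^ k)%N.

Let q_gt1 : (1 < q)%N.
Proof. by rewrite -(exp1n k) ltn_exp2r // prime_gt1 // (pcharf_prime charE). Qed.

Lemma linearized_widen (f : {poly E}) n : (size f <= n)%N ->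
  linearized q f = \sum_(i < n) f`_i *: 'X^(q ^ i)%N.
Proof.
move=> le_fn; rewrite /linearized (big_ord_widen n (fun i => f`_i *: 'X^(q ^ i)%N)) //.
rewrite big_mkcond; apply: eq_bigr => i _.
by case: ltnP => // le_fi; rewrite nth_default // scale0r.
Qed.

Lemma linearizedD (f g : {poly E}) :
  linearized q (f + g) = linearized q f + linearized q g.
Proof.
pose n := maxn (size f) (size g).
rewrite !(@linearized_widen _ n) ?leq_maxl ?leq_maxr //; last exact: size_polyD.
by rewrite -big_split; apply: eq_bigr => i _; rewrite coefD scalerDl.
Qed.

Lemma linearized0 : linearized q (0 : {poly E}) = 0.
Proof. by rewrite /linearized size_poly0 big_ord0. Qed.

Lemma linearizedZX (a : E) n : linearized q (a *: 'X^n) = a *: 'X^(q ^ n)%N.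
Proof.
rewrite (@linearized_widen _ n.+1) ?(leq_trans (size_scale_leq _ _)) ?size_polyXn //.
rewrite big_ord_recr /= coefZ coefXn eqxx mulr1 big1 ?add0r // => i _.
by rewrite coefZ coefXn ltn_eqF ?ltn_ord // mulr0 scale0r.
Qed.

Lemma linearized_sum (I : finType) (f : I -> {poly E}) :
  linearized q (\sum_i f i) = \sum_i linearized q (f i).
Proof. exact: (big_morph _ linearizedD linearized0). Qed.

Lemma size_linearized (f : {poly E}) : f != 0 ->
  size (linearized q f) = (q ^ (size f).-1).+1.
Proof.
move=> nz_f; apply/eqP; rewrite eqn_leq; apply/andP; split.
  apply: (leq_trans (size_sum _ _ _)); apply/bigmax_leqP => i _.
  apply: (leq_trans (size_scale_leq _ _)); rewrite size_polyXn ltnS leq_exp2l //.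
  by rewrite -ltnS prednK ?size_poly_gt0.
rewrite ltnNge; apply/negP => /leq_sizeP/(_ _ (leqnn _))/eqP.
rewrite /linearized; case Dn: (size f) (nz_f) => [|n] nzf.
  by move: nz_f; rewrite -size_poly_eq0 Dn.
rewrite coef_sum big_ord_recr big1 /= => [|i _].
  rewrite coefZ coefXn eqxx mulr1 -[n]/(n.+1.-1) -Dn -lead_coefE.
  by rewrite add0r lead_coef_eq0 (negPf nz_f).
by rewrite coefZ coefXn eqn_exp2l // gtn_eqF ?mulr0 ?ltn_ord.
Qed.

Lemma frobenius_sum (R : comNzRingType) (I : finType) (f : I -> R) n :
  p \in [pchar R] -> (\sum_i f i) ^+ (q ^ n) = \sum_i f i ^+ (q ^ n).
Proof.
move=> charR; rewrite -expnM.
have pn : [pchar R].-nat (p ^ (k * n))%N.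
  by rewrite pnatX (pnatE _ (pcharf_prime charR)) charR.
apply: (big_morph (fun x => x ^+ (p ^ (k * n))) (id1 := 0)).
  by move=> x y; apply: exprDn_pchar.
by rewrite expr0n gtn_eqF // expn_gt0 prime_gt0 // (pcharf_prime charR).
Qed.

Lemma linearized_comp (f h : {poly E}) :
  linearized q f \Po h = \sum_(i < size f) f`_i *: h ^+ (q ^ i).
Proof.
rewrite /linearized raddf_sum; apply: eq_bigr => i _.
by rewrite /= comp_polyZ comp_Xn_poly.
Qed.

(** The twisted product encodes composition: raising to the power q^i is
    additive on the polynomial ring. *)
Lemma linearized_twisted_mul (f g : {poly E}) :
  linearized q (twisted_mul q f g) = linearized q f \Po linearized q g.
Proof.
have charP : p \in [pchar {poly E}].
  by rewrite (fmorph_pchar (@polyC E)).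
rewrite linearized_comp /twisted_mul linearized_sum; apply: eq_bigr => i _.
rewrite linearized_sum [in RHS]/linearized frobenius_sum // scaler_sumr.
apply: eq_bigr => j _.
by rewrite linearizedZX exprZn -exprM scalerA -expnD addnC.
Qed.

End Linearized.

(** * Torsion of a Drinfeld module of rank one *)
Section Drinfeld.
Variables (p k : nat) (F : finFieldType).
Hypotheses (pr_p : prime p) (k_gt0 : (0 < k)%N) (cardF : #|F| = (p ^ k)%N).

Lemma pchar_card : p \in [pchar F].
Proof. exact: card_finPcharP cardF pr_p. Qed.

Variables (K : fieldExtType (ratfun F)) (vinf : place K).
Local Notation A := (regular_ring vinf).

Lemma fconstM : {morph @fconst F K : a b / a * b}.
Proof. by move=> a b; rewrite /fconst polyCM !rmorphM. Qed.
Lemma fconst1 : fconst K 1 = 1.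
Proof. by rewrite /fconst !rmorph1. Qed.
Lemma fconst0 : fconst K 0 = 0.
Proof. by rewrite /fconst !rmorph0. Qed.

Lemma pchar_K : p \in [pchar K].
Proof.
rewrite (fmorph_pchar (in_alg K)) !inE pr_p /= -(rmorph_nat (@tofrac _)).
rewrite -[_%:R](rmorph_nat (@polyC F)) /= (pcharf0 pchar_card).
by rewrite !rmorph0.
Qed.

Lemma regular_fconst c : A (fconst K c).
Proof.
have [->|nz_c] := eqVneq c 0; first by rewrite fconst0; apply: regular0.
have card_gt1 : (1 < #|F|)%N.
  by rewrite cardF -(exp1n k) ltn_exp2r // prime_gt1.
apply: (@regular_unity _ vinf _ #|F|.-1); first by rewrite -subn1 subn_gt0.
have fX n : fconst K c ^+ n = fconst K (c ^+ n).
  by elim: n => [|n IHn]; rewrite ?fconst1 // !exprS fconstM IHn.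
rewrite fX -fconst1; congr (fconst K _); apply: (mulfI nz_c).
by rewrite mulr1 -exprS prednK ?expf_card // ltnW.
Qed.

Variables (E : fieldExtType K) (phi : drinfeld_module A E).
Hypothesis rank1 : has_rank phi 1.
Hypothesis h1 : class_number_is A 1.

Lemma pchar_E : p \in [pchar E].
Proof. by rewrite (fmorph_pchar (in_alg E)) pchar_K. Qed.

Lemma rho_neq0 a : A a -> a != 0 -> phi a != 0.
Proof.
move=> Aa; apply: contra_neq => phi0; have := rho_delta phi Aa.
by rewrite phi0 coef0 => /esym/eqP; rewrite fmorph_eq0 => /eqP.
Qed.

Lemma linearized_rhoM a b : A a -> A b ->
  linearized #|F| (phi (a * b)) = linearized #|F| (phi a) \Po linearized #|F| (phi b).
Proof. by move=> Aa Ab; rewrite rhoM // cardF (linearized_twisted_mul _ pchar_E). Qed.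

(** The degree in tau is additive, read off from the degree of a composite of
    linearized polynomials. *)
Lemma size_rhoM a b : A a -> A b -> a != 0 -> b != 0 ->
  (size (phi (a * b)%R)).-1 = ((size (phi a)).-1 + (size (phi b)).-1)%N.
Proof.
move=> Aa Ab nz_a nz_b.
have Aab := regularM Aa Ab; have nz_ab : a * b != 0 by rewrite mulf_neq0.
have [[nzA nzB] nzAB] := (rho_neq0 Aa nz_a, rho_neq0 Ab nz_b, rho_neq0 Aab nz_ab).
have := size_comp_poly (linearized #|F| (phi a)) (linearized #|F| (phi b)).
rewrite -linearized_rhoM // cardF.
rewrite !(size_linearized pchar_E k_gt0) //= -expnD => /eqP.
rewrite eqn_exp2l => [/eqP//|].
by rewrite -(exp1n k) ltn_exp2r // prime_gt1.
Qed.

(** Rank one makes the degree in tau the dimension of A/aA, so degree zero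
    means aA = A. *)
Lemma size_rho_unit a : A a -> a != 0 -> (size (phi a)).-1 = 0%N -> A_unit A a.
Proof.
move=> Aa nz_a; have [d [b [_ db]] ->] := rank1 Aa nz_a.
rewrite mul1n => d0; subst d.
have [c [[u Au] ]] := db 1 (@regular1 K vinf).
by rewrite big_ord0 subr0 => Du _; split=> //; exists u.
Qed.

Section Act.
Variables (M : fieldType) (e : {rmorphism E -> M}).
Local Notation act := (drinfeld_act phi e).

Lemma actE n a u : (size (phi a) <= n)%N ->
  act a u = \sum_(i < n) e (phi a)`_i * u ^+ ((p ^ k) ^ i)%N.
Proof.
move=> le_n; rewrite /drinfeld_act cardF (linearized_widen _ _ le_n) raddf_sum /=.
rewrite horner_sum; apply: eq_bigr => i _.
by rewrite map_polyZ map_polyXn hornerZ hornerXn.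
Qed.

Lemma pchar_M : p \in [pchar M].
Proof. by rewrite (fmorph_pchar e) pchar_E. Qed.

Lemma act_addr a u v : act a (u + v) = act a u + act a v.
Proof.
rewrite !(actE _ (leqnn _)) -big_split; apply: eq_bigr => i _ /=.
have := @frobenius_sum p k M 'I_2 (fun j => if j == 0 then u else v) i pchar_M.
by rewrite !big_ord_recl !big_ord0 !addr0 /= => ->; rewrite mulrDr.
Qed.

Lemma act_r0 a : act a 0 = 0.
Proof. by apply: (addrI (act a 0)); rewrite -act_addr !addr0. Qed.

Lemma act_oppr a u : act a (- u) = - act a u.
Proof. by apply: (addrI (act a u)); rewrite -act_addr !subrr act_r0. Qed.

Lemma act_addl a b u : A a -> A b -> act (a + b) u = act a u + act b u.
Proof.
move=> Aa Ab; rewrite /drinfeld_act rhoD // cardF linearizedD.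
by rewrite rmorphD hornerD.
Qed.

Lemma act_mul a b u : A a -> A b -> act (a * b) u = act a (act b u).
Proof.
move=> Aa Ab; rewrite /drinfeld_act linearized_rhoM //.
by rewrite map_comp_poly horner_comp.
Qed.

Lemma act_comm a b u : A a -> A b -> act a (act b u) = act b (act a u).
Proof. by move=> Aa Ab; rewrite -!act_mul // mulrC. Qed.

Lemma act_1 u : act 1 u = u.
Proof.
have := linearizedZX p k (1 : E) 0; rewrite scale1r -cardF expn0 scale1r => lin1.
rewrite /drinfeld_act -fconst1 rho_const fconst1 rmorph1 lin1.
by rewrite map_polyX hornerX.
Qed.

Lemma act_subl a b u : A a -> A b -> act (a - b) u = act a u - act b u.
Proof.
move=> Aa Ab; apply: (addIr (act b u)).
by rewrite -act_addl ?subrK //; apply: regularB.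
Qed.

Lemma act_unit m u : A_unit A m -> act m u = 0 -> u = 0.
Proof.
by case=> Am [b Ab mb] mu; rewrite -(act_1 u) -mb mulrC act_mul // mu act_r0.
Qed.

(** The annihilator of z is a principal ideal containing the irreducible m and
    different from A, so m generates it. *)
Lemma annihilator_irreducible_torsion m z :
    A_irreducible A m -> z != 0 -> act m z = 0 ->
  forall a, A a -> act a z = 0 -> principal_ideal A m a.
Proof.
case=> Am nz_m _ irr nz_z mz a Aa az.
have [|g annE] := @class_number1_principal _ vinf (fun a => A a /\ act a z = 0) h1.
  split; first by exists m.
  - move=> x y [Ax xz] [Ay yz]; split; first exact: regularD.
    by rewrite act_addl // xz yz addr0.
  - move=> x y Ax [Ay yz]; split; first exact: regularM.
    by rewrite act_mul // yz act_r0.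
  exists 1; split=> [||x [Ax _]]; [exact: regular1 | exact: oner_neq0 | by rewrite mul1r].
have [Ag gz] : A g /\ act g z = 0.
  by apply/annE; exists 1; rewrite ?mulr1 //; apply: regular1.
have [b Ab Dm] : principal_ideal A g m by apply/annE.
have [/act_unit/(_ gz) z0|[_ [b' Ab' bb']]] := irr g b Ag Ab Dm.
  by rewrite z0 eqxx in nz_z.
have [c Ac ->] : principal_ideal A g a by apply/annE.
by exists (b' * c); [apply: regularM | rewrite Dm mulrA -(mulrA g) bb' mulr1].
Qed.

(** The m-torsion is a simple module. The multiples of z form a copy of A/mA,
    which has q^d elements for d the degree of m, and by rank one rho_m(U) has
    degree q^d, so that these multiples exhaust its roots. *)
Lemma irreducible_torsion_cyclic m z u :
    A_irreducible A m -> z != 0 -> act m z = 0 ->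
  act m u = 0 -> exists2 b, A b & u = act b z.
Proof.
move=> irr_m nz_z mz mu; have [Am nz_m _ _] := irr_m.
have [d [b [Ab db]] sz_m] := rank1 Am nz_m; rewrite mul1n in sz_m.
pose a (c : {ffun 'I_d -> F}) := \sum_i fconst K (c i) * b i.
have Aa c : A (a c).
  by apply: regular_sum => i; apply: regularM => //; apply: regular_fconst.
pose f c := act (a c) z; pose P := map_poly e (linearized #|F| (phi m)).
have f_inj : injective f.
  move=> c c' eq_f; have := db (a c) (Aa c).
  case=> c0 [_ uniq_c]; have <- : c0 = c.
    by apply: uniq_c; rewrite subrr; exists 0; [apply: regular0 | rewrite mulr0].
  apply: uniq_c; apply: (annihilator_irreducible_torsion irr_m nz_z mz).
    exact: (regularB (Aa c) (Aa c')).
  by rewrite (act_subl z (Aa c) (Aa c')); apply/eqP; rewrite subr_eq0; apply/eqP.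
have szP : size P = (#|F| ^ d).+1.
  by rewrite size_map_poly cardF (size_linearized pchar_E k_gt0) ?sz_m // rho_neq0.
have nzP : P != 0 by rewrite -size_poly_gt0 szP.
have rootP v : act m v = 0 -> root P v by move=> mv; apply/eqP.
have [/codomP[c ->]|f'u] := boolP (u \in codom f); first by exists (a c).
suffices: (size (u :: codom f) < size P)%N.
  by rewrite /= size_codom card_ffun card_ord szP ltnn.
apply: max_poly_roots => //; last first.
  by rewrite /= f'u map_inj_uniq ?enum_uniq.
rewrite /= rootP //; apply/allP => _ /codomP[c ->]; apply: rootP.
by rewrite act_comm // mz act_r0.
Qed.

(** By induction on the degree in tau of the annihilating element a: if a is
    reducible, a proper factor kills y or a nonzero multiple of y. *)
Lemma irreducible_torsion_multiple a y :
    A a -> a != 0 -> act a y = 0 -> y != 0 ->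
  exists b m, [/\ A b, A_irreducible A m, act b y != 0 & act m (act b y) = 0].
Proof.
move: {2}_.+1 (ltnSn (size (phi a)).-1) => n.
elim: n a y => // n IHn a y lt_n Aa nz_a ay nz_y.
have nua : ~ A_unit A a by move=> /act_unit/(_ ay)/eqP; rewrite (negPf nz_y).
apply: Classical_Prop.NNPP => no_irr; apply: (no_irr).
exists 1, a; rewrite act_1; split=> //; first exact: regular1.
split=> // a1 a2 Aa1 Aa2 Da; apply: Classical_Prop.NNPP => nu.
apply: no_irr.
have /andP[nz1 nz2] : (a1 != 0) && (a2 != 0).
  by rewrite -negb_or -mulf_eq0 -Da.
have s1 : (0 < (size (phi a1)).-1)%N.
  by rewrite lt0n; apply/eqP => s1; apply: nu; left; apply: size_rho_unit.
have s2 : (0 < (size (phi a2)).-1)%N.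
  by rewrite lt0n; apply/eqP => s2; apply: nu; right; apply: size_rho_unit.
have [lt1 lt2] : ((size (phi a1)).-1 < n)%N /\ ((size (phi a2)).-1 < n)%N.
  move: lt_n; rewrite Da size_rhoM // ltnS => le_n.
  split; apply: leq_trans le_n; first by rewrite -[X in (X < _)%N]addn0 ltn_add2l.
  by rewrite -[X in (X < _)%N]add0n ltn_add2r.
have [y2|nz_y2] := eqVneq (act a2 y) 0; first exact: IHn y2 nz_y.
have [|b [m [Ab irr_m]]] := IHn a1 _ lt1 Aa1 nz1 _ nz_y2.
  by rewrite -act_mul // -Da.
rewrite -act_mul // => nz_b mb; exists (b * a2), m; split=> //.
exact: regularM.
Qed.

End Act.

Lemma drinfeld_act_rmorph (M M' : fieldType)
    (e : {rmorphism E -> M}) (e' : {rmorphism E -> M'})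
    (i : {rmorphism M -> M'}) a u : (forall x, i (e x) = e' x) ->
  i (drinfeld_act phi e a u) = drinfeld_act phi e' a (i u).
Proof.
move=> ie; rewrite /drinfeld_act -horner_map; congr _.[_].
by apply/polyP=> n; rewrite !coef_map /= ie.
Qed.

(** * The Galois action on torsion *)
Section Galois.
Variables (L : fieldExtType E) (Kbar : closedFieldType).
Variables (iE : {rmorphism E -> Kbar}) (iL : {rmorphism L -> Kbar}).
Hypothesis iEL : forall y : E, iL (in_alg L y) = iE y.
Hypothesis pureL : pure phi iE iL.
Variables (N : splittingFieldType E) (iN : {rmorphism N -> Kbar}) (j : 'AHom(L, N)).
Hypothesis iNj : forall y, iN (j y) = iL y.
Local Notation G := 'Gal({:N} / 1)%G.
Local Notation H := 'Gal({:N} / j @: {:L})%G.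
Local Notation act := (drinfeld_act phi (in_alg N)).
Hypothesis galN : galois 1 {:N}.

Definition torsion_point (y : N) :=
  exists a, [/\ regular_ring vinf a, a != 0 & act a y = 0].
Definition irreducible_torsion_point (z : N) :=
  exists m, [/\ A_irreducible (regular_ring vinf) m, z != 0 & act m z = 0].

Lemma ahom_alg a : j a%:A = a%:A.
Proof. by rewrite linearZ rmorph1. Qed.

Lemma iN_alg a : iN a%:A = iE a.
Proof. by rewrite -ahom_alg iNj iEL. Qed.

Lemma gal_act (g : gal_of {:N}) a u : g (act a u) = act a (g u).
Proof.
apply: (@drinfeld_act_rmorph N N (in_alg N) (in_alg N) (g : {rmorphism N -> N})) => x /=.
by rewrite linearZ rmorph1.
Qed.

(** An automorphism g acts on the simple module A z by a scalar b; scalars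
    commute with any further automorphism h. *)
Lemma irreducible_point_gal (g : gal_of {:N}) z : irreducible_torsion_point z ->
  exists2 b, regular_ring vinf b & forall h : gal_of {:N}, h (g z) = act b (h z).
Proof.
case=> m [irr_m nz_z mz].
have mgz : act m (g z) = 0 by rewrite -gal_act mz rmorph0.
have [b Ab gzE] := irreducible_torsion_cyclic irr_m nz_z mz mgz.
by exists b => // h; rewrite gzE gal_act.
Qed.

Lemma irreducible_point_comm z : irreducible_torsion_point z ->
  forall g h : gal_of {:N},
  (g * h)%g z = (h * g)%g z.
Proof.
move=> simz g h; rewrite !galM ?memvf //.
have [b Ab gz] := irreducible_point_gal g simz.
have [c Ac hz] := irreducible_point_gal h simz.
have gz1 := gz 1%g; have hz1 := hz 1%g; rewrite !gal_id in gz1 hz1.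
by rewrite gz hz hz1 gz1; apply: act_comm.
Qed.

(** If g has order n, a power of p, and acts on z by the scalar a, then
    (a - 1)^n = a^n - 1 kills z. Were (a - 1) z nonzero, it would generate A z:
    z = b (a - 1) z, and iterating, z = b^n (a - 1)^n z = 0. *)
Lemma irreducible_point_pgroup z : irreducible_torsion_point z ->
  forall g : gal_of {:N}, p.-nat #[g]%g -> g z = z.
Proof.
move=> simz g pg; have [m [irr_m nz_z mz]] := simz.
have [Am _ _ _] := irr_m; have [a Aa gzE] := irreducible_point_gal g simz.
have := gzE 1%g; rewrite !gal_id => gz.
have A1 := @regular1 K vinf.
have AX c n : regular_ring vinf c -> regular_ring vinf (c ^+ n).
  by move=> Ac; elim: n => [|n IHn]; rewrite ?expr0 // exprS; apply: regularM.
pose d := a - 1; have Ad : regular_ring vinf d := regularB Aa A1.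
have dzE : act d z = g z - z by rewrite act_subl // act_1 gz.
apply/eqP; rewrite -subr_eq0 -dzE; apply/negP => /negP nz_dz.
have [b Ab zE] : exists2 b, regular_ring vinf b & z = act b (act d z).
  by apply: (irreducible_torsion_cyclic irr_m) => //; rewrite act_comm // mz act_r0.
have bdX n : z = act (b ^+ n) (act (d ^+ n) z).
  rewrite -(act_mul _ _ (AX b n Ab) (AX d n Ad)) -exprMn.
  elim: n => [|n IHn]; first by rewrite expr0 act_1.
  have Abd : regular_ring vinf (b * d) := regularM Ab Ad.
  by rewrite exprSr (act_mul _ _ (AX _ n Abd) Abd) (act_mul _ _ Ab Ad) -zE.
have aX n : act (a ^+ n) z = (g ^+ n)%g z.
  elim: n => [|n IHn]; first by rewrite expr0 act_1 gal_id.
  rewrite exprSr expgS (act_mul _ _ (AX a n Aa) Aa) -gz galM ?memvf //.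
  by rewrite -gal_act IHn -!galM ?memvf // -expgS -expgSr.
have pK : [pchar K].-nat #[g]%g.
  by apply: sub_in_pnat pg => q _ /eqP ->; apply: pchar_K.
have daX : a ^+ #[g]%g = d ^+ #[g]%g + 1.
  by have := exprDn_pchar d 1 pK; rewrite subrK expr1n.
have := aX #[g]%g; rewrite expg_order gal_id daX (act_addl _ _ (AX d _ Ad) A1) act_1.
move/eqP; rewrite -subr_eq0 addrK => /eqP dz0.
by move: nz_z; rewrite (bdX #[g]%g) dz0 act_r0 eqxx.
Qed.

(** If H fixes z then z lies in L, and it generates the m-torsion by
    simplicity; purity puts it in E. *)
Lemma irreducible_point_pure z : irreducible_torsion_point z ->
  {in H, forall h, (h : gal_of {:N}) z = z} -> forall g : gal_of {:N}, g z = z.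
Proof.
move=> [m [irr_m nz_z mz]] Hz g; have [Am nz_m _ _] := irr_m.
have galjL : galois (j @: {:L}) {:N}.
  by apply: galoisS galN; rewrite sub1v subvf.
have : z \in fixedField H by apply/fixedFieldP; rewrite ?memvf.
rewrite (galois_fixedField galjL) => /memv_imgP[x _ Dz].
have iNact a u : iN (act a u) = drinfeld_act phi iE a (iN u).
  by apply: drinfeld_act_rmorph => y; apply: iN_alg.
have mNz : drinfeld_act phi iE m (iN z) = 0 by rewrite -iNact mz rmorph0.
have tors_z : torsion_generator phi iE m (iN z).
  split=> [_ [b Ab ->]|u tu]; first by rewrite mulrC act_mul // mNz act_r0.
  apply: (irreducible_torsion_cyclic irr_m) => //; first by rewrite fmorph_eq0.
  by apply: tu; exists 1; rewrite ?mulr1 //; apply: regular1.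
have [|y Dy] := pureL irr_m tors_z; first by exists x; rewrite Dz iNj.
have -> : z = y%:A by apply: (fmorph_inj iN); rewrite iN_alg.
by rewrite linearZ rmorph1.
Qed.

Lemma torsion_point_sub x y :
  torsion_point x -> torsion_point y -> torsion_point (x - y).
Proof.
move=> [a [Aa nz_a ax]] [b [Ab nz_b bY]]; exists (a * b); split.
- exact: regularM.
- by rewrite mulf_neq0.
rewrite act_addr act_oppr {1}mulrC !act_mul // ax bY !act_r0 subrr //.
Qed.

Lemma torsion_point_gal x (g : gal_of {:N}) : torsion_point x -> torsion_point (g x).
Proof.
by case=> a [Aa nz_a ax]; exists a; split=> //; rewrite -gal_act ax rmorph0.
Qed.

Lemma DrinT_displacement u (g : gal_of {:N}) :
  DrinT phi u -> torsion_point (g (j u) - j u).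
Proof.
case=> m [Am nz_m [y my]]; exists m; split=> //.
have mju : act m (j u) = y%:A.
  transitivity (j (drinfeld_act phi (in_alg L) m u)); last by rewrite my; apply: ahom_alg.
  apply/esym/(@drinfeld_act_rmorph L N (in_alg L) (in_alg N) j) => x.
  exact: ahom_alg.
by rewrite act_addr act_oppr -gal_act mju linearZ rmorph1 subrr.
Qed.

Variable X : L -> Prop.
Hypotheses (XT : forall u, X u -> DrinT phi u) (genX : generated_by X).

(** The elements of L fixed by g form a subfield, and X generates L. *)
Lemma fixes_L (g : gal_of {:N}) : (forall u, X u -> g (j u) = j u) ->
  forall y, g (j y) = j y.
Proof.
move=> gX; pose U := (j @^-1: fixedField [set g])%VS.
have memU y : (y \in U) = (g (j y) == j y).
  rewrite -memv_preim; apply/(fixedFieldP (memvf _))/eqP => [fixj|gj h].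
    by apply: fixj; rewrite inE.
  by rewrite inE => /eqP->.
have algU : is_aspace U.
  rewrite /is_aspace has_algid1 ?memU ?rmorph1 //=.
  apply/prodvP => x y; rewrite !memU rmorphM /= => /eqP gx /eqP gy; apply/eqP.
  by transitivity (g (j x) * g (j y)); [apply: rmorphM | rewrite gx gy].
have genU : U = fullv.
  by apply: (genX (M := ASpace algU)) => u /gX/eqP; rewrite -memU.
by move=> y; apply/eqP; rewrite -memU genU memvf.
Qed.

Lemma H_fixes (g : gal_of {:N}) : g \in H <-> forall u, X u -> g (j u) = j u.
Proof.
split=> [Hg u _|/fixes_L gj].
  exact: (fixed_gal (subvf _) Hg (memv_img _ (memvf _))).
rewrite gal_kHom ?subvf //; apply/kAHomP => _ /memv_imgP[y _ ->]; exact: gj.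
Qed.

Hypothesis faithN : forall g, g \in G ->
  (forall (h : gal_of {:N}) y, h \in G -> g (h (j y)) = h (j y)) -> g = 1%g.

Lemma index_pgroup : p.-nat #|G : H|%g.
Proof.
pose act_gal (v : N) (g : gal_of {:N}) : N := g v.
apply: (@index_pnat p _ G N act_gal _ _ _ _ torsion_point
  irreducible_torsion_point _ _ _ H (fun v => exists2 u, X u & v = j u)) => //.
- by move=> v; apply: (mulrn_pchar (pchar_M (in_alg N))).
- by move=> g _ u v; apply: rmorphD.
- by move=> u; apply: gal_id.
- by move=> g h _ _ u; apply: galM; apply: memvf.
- exact: torsion_point_sub.
- by move=> x g _; apply: torsion_point_gal.
- move=> y [a [Aa nz_a ay]] nz_y.
  have [b [m [Ab irr_m nz_by mby]]] := irreducible_torsion_multiple Aa nz_a ay nz_y.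
  exists (act b); split=> //; last by exists m.
    by move=> u v; apply: act_addr.
  by move=> g _ u; apply: gal_act.
- by apply: galS; apply: sub1v.
- by move=> z simz g h _ _; apply: irreducible_point_comm.
- by move=> z simz g _; apply: irreducible_point_pgroup.
- by move=> z simz Hz g _; apply: irreducible_point_pure.
- by move=> _ [u Xu ->] g _; apply: DrinT_displacement; apply: XT.
- move=> g _; split=> [/H_fixes gX _ [u Xu ->]|gX]; first exact: gX.
  by apply/H_fixes => u Xu; apply: gX; exists u.
move=> g Gg gXh; apply: faithN => // h y Gh.
have : (h * g * h^-1)%g (j y) = j y.
  apply: fixes_L => u Xu; rewrite !galM ?memvf //.
  have := gXh (j u) h; rewrite /act_gal => -> //; last by exists u.
  by rewrite -galM ?memvf // mulgV gal_id.
rewrite !galM ?memvf // => ghy.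
by rewrite -[in RHS]ghy -[RHS]galM ?memvf // mulVg gal_id.
Qed.

(** The Galois correspondence, for the image of L in N. *)
Lemma index_dim : #|G : H|%g = \dim {:L}.
Proof.
have galjL : galois (j @: {:L}) {:N} by apply: galoisS galN; rewrite sub1v subvf.
have cardG : #|G|%g = \dim {:N} by rewrite -(galois_dim galN) dimv1 divn1.
have dimjL : \dim (j @: {:L}) = \dim {:L}.
  by apply: limg_dim_eq; rewrite (eqP (AHom_lker0 j)) capv0.
have dimN : \dim {:N} = (#|H|%g * \dim {:L})%N.
  by rewrite -(galois_dim galjL) -dimjL; apply: dim_sup_field (subvf _).
apply/eqP; rewrite -(eqn_pmul2l (cardG_gt0 H)) Lagrange ?galS ?sub1v //.
by rewrite cardG dimN.
Qed.

End Galois.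
End Drinfeld.

Theorem theorem5p11 (p k : nat) (hp : prime p) (hk : (0 < k)%N)
  (F : finFieldType) (hq : #|F| = (p ^ k)%N)
  (K : fieldExtType (ratfun F)) (hK : full_constant_field K)
  (vinf : place K) (hA : class_number_is (regular_ring vinf) 1)
  (E : fieldExtType K)
  (phi : drinfeld_module (regular_ring vinf) E) (hphi : has_rank phi 1)
  (Kbar : closedFieldType) (iE : {rmorphism E -> Kbar})
  (hKbar : forall z : Kbar, algebraicOver (fun x : K => iE (in_alg E x)) z)
  (L : fieldExtType E) (iL : {rmorphism L -> Kbar})
  (hiL : forall y : E, iL (in_alg L y) = iE y)
  (hL : cyclotomic_coradical phi iE iL) :
  exists n : nat, \dim {:L} = (p ^ n)%N.
Proof.
have [[X [XT genX]] sepL pureL] := hL.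
have [N [iN [j [galN iNj faithN]]]] := exists_galois_closure iL sepL.
have pG := index_pgroup hp hk hq hphi hA hiL pureL iNj galN XT genX faithN.
by have [n Dn] := p_natP pG; exists n; rewrite -Dn (index_dim j galN).
Qed.
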